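(* Let $G$ be a finite group with $Z(G)=1$. Then $C_G(G')\leq G'$.
   Context: $G'$ is the derived (commutator) subgroup of $G$, $Z(G)$ is the centre of $G$, and $C_G(G')$ is the centralizer of $G'$ in $G$. *)

(* Defs.v *)
From mathcomp Require Import all_boot all_fingroup all_solvable.

(* Main.v *)
Require Import Defs.
From mathcomp Require Import all_boot all_fingroup all_solvable.

Local Open Scope group_scope.

(** Put C = C_G(G'). Since [C, G] lies in G', which C centralises, the three
    subgroup lemma puts C' in Z(G) = 1, so C is abelian
    ([abelian_cent_der1]). The conjugation action of G on C factors through
    the abelian group G / G', and its fixed points lie in Z(G) = 1.

    A finite module M without nonzero fixed points under a commutative group
    satisfies M = [M, G] ([commG_fixfree]); applied to C this gives
    C = [C, G], hence C is contained in G'. The point is that, the action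
    being commutative, x |-> [x, g] is an endomorphism of the G-module M for
    each g in G ([commgJ_cent_der1]). When g acts nontrivially and the
    endomorphism is not onto, its kernel and its image are smaller submodules
    of M, again without fixed points, and the equality for M follows from the
    equality for these two pieces. *)

Section ActionThroughAbelianization.

Variables (gT : finGroupType) (G : {group gT}).
Implicit Type M : {group gT}.

(** As g ^ h and g differ by an element of G', they act in the same way
    on M. *)
Lemma commgJ_cent_der1 M g h x :
    G \subset 'N(M) -> M \subset 'C(G^`(1)) -> g \in G -> h \in G -> x \in M ->
  [~ x, g] ^ h = [~ x ^ h, g].
Proof.
move=> nMG cMG' Gg Gh Mx.
have Mxh : x ^ h \in M by rewrite memJ_norm ?(subsetP nMG).
have cG' y : y \in M -> [~ y, [~ g, h]] = 1.
  move=> /(subsetP cMG')/centP cyG'; apply/eqP/commgP.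
  by apply: cyG'; rewrite mem_commg.
rewrite conjRg (conjg_mulR g h) commgMJ cG' // mul1g conjg_mulR cG' ?mulg1 //.
by rewrite commgEl groupM ?groupV ?memJ_norm ?(subsetP nMG).
Qed.

(** Induction on the order of M. For g in G acting nontrivially on M, the
    endomorphism phi : x |-> [x, g] has a proper kernel K. If phi is onto, M
    consists of commutators; otherwise induction applies to K and to phi M,
    which are G-invariant because phi commutes with G, and which inherit the
    absence of fixed points as subgroups of M. *)
Lemma commG_fixfree M :
    G \subset 'N(M) -> M \subset 'C(G^`(1)) -> abelian M ->
  M :&: 'C(G) = 1 -> [~: M, G] = M.
Proof.
move=> nMG cMG' abM regM; apply/eqP; rewrite eqEsubset commg_subl nMG /=.
have [n] := ubnP #|M|; elim: n => // n IHn in M nMG cMG' abM regM *.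
rewrite ltnS => leMn.
have sub_fixfree (K : {group gT}) :
    K \proper M -> G \subset 'N(K) -> K \subset [~: K, G].
  move=> ltKM nKG; have sKM := proper_sub ltKM.
  apply: IHn; rewrite ?(subset_trans sKM) ?(abelianS sKM) //.
    by apply/trivgP; rewrite -regM setSI.
  exact: leq_trans (proper_card ltKM) leMn.
have [cMG | /subsetPn[g Gg ncMg]] := boolP (G \subset 'C(M)).
  have /setIidPl <- : M \subset 'C(G) by rewrite centsC.
  by rewrite regM sub1G.
have MJ x h : x \in M -> h \in G -> x ^ h \in M.
  by move=> Mx Gh; rewrite memJ_norm ?(subsetP nMG).
have Mcomm x h : x \in M -> h \in G -> [~ x, h] \in M.
  by move=> Mx Gh; rewrite commgEl groupM ?groupV ?MJ.
have phiM : {in M &, {morph commg^~ g : x y / x * y}}.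
  move=> x y Mx My /=; rewrite commMgJ; congr (_ * _).
  by rewrite /conjg (centsP abM _ (Mcomm x g Mx Gg) y My) mulKg.
pose phi := Morphism phiM.
have phiJ x h : x \in M -> h \in G -> phi x ^ h = phi (x ^ h).
  by move=> Mx Gh; apply: commgJ_cent_der1 nMG cMG' Gg Gh Mx.
have nKG : G \subset 'N('ker phi).
  apply/subsetP=> h Gh; rewrite inE; apply/subsetP=> _ /imsetP[x Kx ->].
  have Mx := dom_ker Kx.
  by apply/(kerP phi (MJ x h Mx Gh)); rewrite -phiJ // (mker Kx) conj1g.
have nNG : G \subset 'N(phi @* M).
  apply/subsetP=> h Gh; rewrite inE.
  apply/subsetP=> _ /imsetP[_ /morphimP[x Mx _ ->] ->].
  by rewrite phiJ // mem_morphim ?MJ.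
have ltKM : 'ker phi \proper M.
  rewrite properE subsetIl /=; apply: contra ncMg => /subsetP sMK.
  by apply/centP=> x /sMK/mker/eqP/commgP/commute_sym.
have sNM : phi @* M \subset M.
  by apply/subsetP=> _ /morphimP[x Mx _ ->]; apply: Mcomm.
have sNR : phi @* M \subset [~: M, G].
  by apply/subsetP=> _ /morphimP[x Mx _ ->]; apply: mem_commg.
have [eqNM | ltNM] := eqVproper sNM; first by rewrite -{1}eqNM.
(* Since phi commutes with G, it maps [M, G] onto [phi M, G] = phi M: thus
   M = [M, G] ker phi, and the kernel lies in [M, G] by induction. *)
have sNphiR : phi @* M \subset phi @* [~: M, G].
  apply: subset_trans (sub_fixfree _ ltNM nNG) _; rewrite gen_subG.
  apply/subsetP=> _ /imset2P[_ h /morphimP[x Mx _ ->] Gh ->].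
  rewrite commgEl phiJ // -morphV // -morphM ?groupV ?MJ //.
  by rewrite -commgEl mem_morphim ?Mcomm ?mem_commg.
have sKR : 'ker phi \subset [~: M, G].
  exact: subset_trans (sub_fixfree _ ltKM nKG) (commSg _ (proper_sub ltKM)).
by rewrite -(morphimSGK _ sKR).
Qed.

(** With C = C_G(G') one has [C, G, C] = [G, C, C] = 1, since [C, G] lies in
    G'; the three subgroup lemma turns this into [C, C, G] = 1. *)
Lemma abelian_cent_der1 : 'Z(G) = 1 -> abelian 'C_G(G^`(1)).
Proof.
move=> Z1; set C := 'C_G(G^`(1)).
have sCG : C \subset G by apply: subsetIl.
have GCC : [~: G, C, C] = 1.
  apply/commG1P; rewrite centsC; apply: subset_trans (subsetIr _ _) _.
  by rewrite centS ?commgS.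
have CGC : [~: C, G, C] = 1 by rewrite (commGC C).
have /commG1P cC'G : [~: C, C, G] = 1 by apply: three_subgroup CGC GCC.
apply/commG1P/trivgP; rewrite -Z1 subsetI cC'G.
by rewrite andbT; apply: subset_trans (commgSS sCG sCG) (der_sub 1 G).
Qed.

End ActionThroughAbelianization.

Theorem theorem5 (gT : finGroupType) (G : {group gT}) :
  'Z(G) = 1 -> 'C_G(G^`(1)) \subset G^`(1).
Proof.
move=> Z1.
have nCG : G \subset 'N('C_G(G^`(1))).
  by rewrite normsI ?normG // norms_cent ?der_norm.
have regC : 'C_G(G^`(1)) :&: 'C(G) = 1.
  by apply/trivgP; rewrite -Z1 setSI ?subsetIl.
rewrite -{1}(commG_fixfree _ _ _ nCG (subsetIr _ _) (abelian_cent_der1 _ _ Z1) regC).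
by rewrite commSg ?subsetIl.
Qed.
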